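(* Let $G=\mathbb{Z}/m\mathbb{Z}$ be the cyclic group of order $m$ (written additively), and let $\gamma,\delta\colon G\to\mathrm{Aut}(G)$ be two gamma functions on $G$. Suppose that $\gamma$ is defined modulo $q$ and that $\delta$ is defined modulo $r$. Then $\gamma$ and $\delta$ mutually normalize each other if and only if $$\begin{cases} x\equiv x^{\delta(y)}+y-y^{\gamma(x)}\pmod q\\ x\equiv x^{\gamma(y)}+y-y^{\delta(x)}\pmod r\end{cases}\qquad\text{for all } x,y\in G.$$
   Context: Maps act on the right: $x^\alpha$ is the image of $x$ under $\alpha$, and products of permutations are composed left to right. For a group $G$, $\rho\colon G\to\mathrm{Sym}(G)$ is the right regular representation ($\rho(g)\colon x\mapsto x+g$ in additive notation), and $\mathrm{Hol}(G)=\langle \rho(G),\mathrm{Aut}(G)\rangle\le \mathrm{Sym}(G)$. A subgroup $N\le\mathrm{Hol}(G)$ is regular if it acts regularly on the set $G$. A gamma function on $G$ is a map $\gamma\colon G\to\mathrm{Aut}(G)$ with $\gamma(g^{\gamma(h)}+ h)=\gamma(g)\gamma(h)$ for all $g,h\in G$. Regular subgroups $N\le \mathrm{Hol}(G)$ correspond bijectively to gamma functions via $N=\{\gamma(g)\rho(g): g\in G\}$. Two subgroups of $\mathrm{Sym}(G)$ mutually normalize each other if each is contained in the normalizer of the other in $\mathrm{Sym}(G)$; two gamma functions mutually normalize each other if their associated regular subgroups do. For a positive integer $q\mid m$, a function $\gamma\colon G\to\mathrm{Aut}(G)$ is said to be defined modulo $q$ if for all $x,y\in G$: $\gamma(x)=\gamma(y)$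 if and only if $x\equiv y\pmod q$ (elements of $\mathbb{Z}/m\mathbb{Z}$ being reduced modulo $q$). *)

(* Defs.v *)
From HB Require Import structures.
From mathcomp Require Import all_boot all_order all_algebra all_fingroup.

Set Implicit Arguments.
Unset Strict Implicit.
Unset Printing Implicit Defensive.

Import GroupScope.

(* Permutations act on the right: the image x^a of x under a is written [a x],
   and (a * b) x = b (a x).  The general notions are stated for a
   multiplicatively written finite group; the group law of 'I_n.+1 as a
   finGroupType is addition modulo n.+1, so 'I_n.+1 is Z/(n+1)Z for every
   n (the trivial group included, unlike with 'Z_m). *)

Section GammaFunctions.

Variable gT : finGroupType.
Implicit Types (gamma delta : gT -> {perm gT}) (g h x : gT).

Definition rho g : {perm gT} := actperm 'R g.

Lemma rhoE g x : rho g x = x * g.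
Proof. by rewrite /rho actpermE. Qed.

Definition Hol : {set {perm gT}} := <<rho @: [set: gT] :|: Aut [set: gT]>>.

Definition gamma_function gamma : Prop :=
  (forall g, gamma g \in Aut [set: gT]) /\
  (forall g h, gamma (gamma h g * h) = gamma g * gamma h).

Definition gamma_subgroup gamma : {set {perm gT}} :=
  [set gamma g * rho g | g : gT].

(* The normalizers are taken in the whole of Sym(gT) = {perm gT}. *)
Definition mutually_normalizing (N M : {set {perm gT}}) : bool :=
  (N \subset 'N(M)) && (M \subset 'N(N)).

Definition gamma_mutually_normalize gamma delta : bool :=
  mutually_normalizing (gamma_subgroup gamma) (gamma_subgroup delta).

Lemma gamma_subgroup_group_set gamma :
  gamma_function gamma -> group_set (gamma_subgroup gamma).
Proof.
move=> [gA gM].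
have autM h : {morph gamma h : x y / x * y}.
  by move=> x y; apply: (morphicP (Aut_morphic (gA h))); rewrite inE.
have aut1 h : gamma h 1 = 1.
  by apply: (mulgI (gamma h 1)); rewrite -autM !mulg1.
have g1 : gamma 1 = 1.
  by apply: (mulgI (gamma 1)); rewrite -gM aut1 !mulg1.
apply/group_setP; split=> [|_ _ /imsetP[g _ ->] /imsetP[h _ ->]].
  by apply/imsetP; exists 1 => //; apply/permP=> x; rewrite g1 !permM rhoE !perm1 mulg1.
apply/imsetP; exists (gamma h g * h) => //.
by apply/permP=> x; rewrite gM !permM !rhoE autM mulgA.
Qed.

Lemma gamma_subgroup_sub_Hol gamma :
  gamma_function gamma -> gamma_subgroup gamma \subset Hol.
Proof.
move=> [gA _]; apply/subsetP=> _ /imsetP[g _ ->]; apply: groupM.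
  by apply: mem_gen; rewrite inE gA orbT.
by apply: mem_gen; rewrite inE imset_f ?inE.
Qed.

Lemma gamma_subgroup_regular gamma : gamma_function gamma ->
  forall x y, exists! p : {perm gT}, p \in gamma_subgroup gamma /\ p x = y.
Proof.
move=> gF; have [gA gM] := gF.
pose N := Group (gamma_subgroup_group_set gF).
have aut1 h : gamma h 1 = 1.
  apply: (mulgI (gamma h 1)).
  by rewrite -(morphicP (Aut_morphic (gA h))) ?inE // !mulg1.
have at1 g : (gamma g * rho g) 1 = g by rewrite permM rhoE aut1 mul1g.
have uniq1 p : p \in N -> p = gamma (p 1) * rho (p 1).
  by case/imsetP=> g _ ->; rewrite at1.
have inN g : gamma g * rho g \in N by apply: imset_f.
move=> x y; exists ((gamma x * rho x)^-1 * (gamma y * rho y)); split=> [|q [qN qx]].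
  split; first by rewrite (groupM (groupVr (inN x)) (inN y)).
  rewrite permM (_ : (gamma x * rho x)^-1 x = 1) ?at1 //.
  by apply: (@perm_inj _ (gamma x * rho x)); rewrite permKV at1.
apply: (mulgI (gamma x * rho x)); rewrite mulKVg.
by rewrite (uniq1 _ (groupM (inN x) qN)) permM at1 qx.
Qed.

End GammaFunctions.

(* Elements of Z/(n+1)Z are represented by their least residues, so congruence
   modulo q makes sense because q divides n.+1 (hence also q > 0). *)
Definition defined_modulo (n : nat) (gamma : 'I_n.+1 -> {perm 'I_n.+1})
    (q : nat) : Prop :=
  (q %| n.+1)%N /\
  (forall x y : 'I_n.+1, gamma x = gamma y <-> (x = y %[mod q])%N).

(* Main.v *)
Require Import Defs.
From mathcomp Require Import all_boot all_order all_algebra all_fingroup.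
From mathcomp Require Import cyclic.

(** Write [nu_x = gamma x * rho x] and [mu_y = delta y * rho y] for the elements
of the two regular subgroups.  Saying that [mu_y] conjugates [nu_x] into the
subgroup of [gamma] means that [nu_x * mu_y = mu_y * nu_z] for some [z].  Both
sides are affine maps, so this equation splits into one for the automorphism
parts, [gamma x * delta y = delta y * gamma z], and one for the images of the
identity, which expresses [z] through [y], [x] and [gamma z].  If automorphisms
commute, the first equation becomes [gamma x = gamma z], and the second then
forces [z = (gamma x y)^-1 * (delta y x * y)].  Hence [delta] normalizes
[gamma] exactly when [gamma] takes the same value at [x] and at this [z]
([gamma_subgroup_normP]).

The group [Z/mZ] is cyclic, so its automorphism group is abelian and the
criterion applies.  In additive notation [z] is [delta y x + y - gamma x y], and
when [gamma] is defined modulo [q], the equality [gamma x = gamma z] is the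
congruence [x = z] modulo [q].  The second congruence is the same statement with
[gamma] and [delta] exchanged. *)

Section NormalizingGammaSubgroups.

Local Open Scope group_scope.

Variable gT : finGroupType.
Implicit Types (a b : {perm gT}) (gamma delta : gT -> {perm gT}) (x y z : gT).

Lemma Aut_setT_morph a : a \in Aut [set: gT] -> {morph a : x y / x * y}.
Proof. by move=> aA x y; apply: (morphicP (Aut_morphic aA)); rewrite inE. Qed.

Lemma Aut_setT1 a : a \in Aut [set: gT] -> a 1 = 1.
Proof.
by move=> aA; apply: (mulgI (a 1)); rewrite -(Aut_setT_morph _ aA) !mulg1.
Qed.

Lemma mul_Aut_rho a b x y : b \in Aut [set: gT] ->
  (a * rho x) * (b * rho y) = (a * b) * rho (b x * y).
Proof.
move=> bA; apply/permP=> t.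
by rewrite !permM !rhoE (Aut_setT_morph _ bA) mulgA.
Qed.

(** This is the uniqueness of the decomposition in the semidirect product
[Aut gT * rho gT]: the image of the identity recovers the translation part. *)
Lemma Aut_rho_inj a b x y : a \in Aut [set: gT] -> b \in Aut [set: gT] ->
  a * rho x = b * rho y -> a = b /\ x = y.
Proof.
move=> aA bA eq_ab.
have eq_xy : x = y.
  have /permP/(_ 1) := eq_ab.
  by rewrite !permM !rhoE (Aut_setT1 _ aA) (Aut_setT1 _ bA) !mul1g.
by split=> //; move: eq_ab; rewrite eq_xy; apply: mulIg.
Qed.

(** Commutativity of the automorphism group cancels [delta y] from the equation
between automorphism parts, which is what determines [z] explicitly. *)
Lemma gamma_subgroup_normP gamma delta :
    abelian (Aut [set: gT]) ->
    (forall x, gamma x \in Aut [set: gT]) ->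
    (forall y, delta y \in Aut [set: gT]) ->
  gamma_subgroup delta \subset 'N(gamma_subgroup gamma) <->
  (forall x y, gamma x = gamma ((gamma x y)^-1 * (delta y x * y))).
Proof.
move=> abelA gammaA deltaA.
have commA x y : gamma x * delta y = delta y * gamma x.
  exact: (centsP abelA).
split=> [/subsetP normN x y | gamma_eq].
  have gamma_x : gamma x * rho x \in gamma_subgroup gamma by apply: imset_f.
  have delta_y : delta y * rho y \in gamma_subgroup delta by apply: imset_f.
  have /imsetP[z _ conj_z] :
      (gamma x * rho x) ^ (delta y * rho y) \in gamma_subgroup gamma.
    by rewrite memJ_norm ?normN.
  have := conjgC (gamma x * rho x) (delta y * rho y).
  rewrite conj_z !mul_Aut_rho // commA.
  case/Aut_rho_inj; rewrite ?groupM //.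
  by move=> /mulgI gamma_xz ->; rewrite -gamma_xz mulKg.
apply/subsetP=> _ /imsetP[y _ ->]; rewrite inE.
apply/subsetP=> _ /imsetP[_ /imsetP[x _ ->] ->].
apply/imsetP; exists ((gamma x y)^-1 * (delta y x * y)) => //.
apply: (mulgI (delta y * rho y)); rewrite -conjgC.
by rewrite !mul_Aut_rho // -gamma_eq commA mulKVg.
Qed.

End NormalizingGammaSubgroups.

Lemma Aut_ord_abelian n : abelian (Aut [set: 'I_n.+1]).
Proof.
apply: Aut_cyclic_abelian; apply/cyclicP.
by exists (Zp1 : 'I_n.+1); apply: Zp_cycle.
Qed.

Local Open Scope ring_scope.

Lemma gamma_subgroup_norm_modP n q (gamma delta : 'I_n.+1 -> {perm 'I_n.+1}) :
    gamma_function gamma -> gamma_function delta -> defined_modulo gamma q ->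
  gamma_subgroup delta \subset 'N(gamma_subgroup gamma)%g <->
  (forall x y : 'I_n.+1, (x = (delta y x + y - gamma x y)%R %[mod q])%N).
Proof.
move=> [gammaA _] [deltaA _] [_ gamma_q].
(* The group law of ['I_n.+1] is definitionally its addition. *)
have addE x y :
    ((gamma x y)^-1 * (delta y x * y))%g = delta y x + y - gamma x y.
  exact: GRing.addrC.
have [normE Enorm] := gamma_subgroup_normP _ _ _ (Aut_ord_abelian n) gammaA deltaA.
split=> [/normE eq_gamma x y | eq_mod].
  by apply/gamma_q; rewrite -addE.
by apply: Enorm => x y; rewrite addE; apply/gamma_q.
Qed.

Theorem corollary4p29 (n q r : nat) (gamma delta : 'I_n.+1 -> {perm 'I_n.+1})
  (gammaF : gamma_function gamma) (deltaF : gamma_function delta)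
  (gamma_q : defined_modulo gamma q) (delta_r : defined_modulo delta r) :
  gamma_mutually_normalize gamma delta <->
  (forall x y : 'I_n.+1,
     (x = (delta y x + y - gamma x y)%R %[mod q])%N /\
     (x = (gamma y x + y - delta x y)%R %[mod r])%N).
Proof.
have [norm_q q_norm] := gamma_subgroup_norm_modP _ _ _ _ gammaF deltaF gamma_q.
have [norm_r r_norm] := gamma_subgroup_norm_modP _ _ _ _ deltaF gammaF delta_r.
split=> [/andP[/norm_r mod_r /norm_q mod_q] x y | mod_qr]; first by split.
by apply/andP; split; [apply: r_norm | apply: q_norm] => x y; have [] := mod_qr x y.
Qed.
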